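(* Let $G$ be a finite group and let $p$ be the smallest prime divisor of $|G|$. Then \[\frac{d(G)}{|J_2(G)|}+\frac{|Z^\otimes(G)|}{|G|}\left(1-\frac{1}{|J_2(G)|}\right)\le d^\otimes(G)\le d(G)-\left(1-\frac{1}{p}\right)\left(\frac{|Z(G)|-|Z^\otimes(G)|}{|G|}\right).\]
   Context: All groups are finite. For elements of a group write ${}^{x}y=xyx^{-1}$ and $[x,y]=xyx^{-1}y^{-1}$. The nonabelian tensor square $G\otimes G$ of a group $G$ is the group generated by the symbols $g\otimes h$ ($g,h\in G$) with defining relations $xy\otimes h=({}^{x}y\otimes{}^{x}h)(x\otimes h)$ and $x\otimes hk=(x\otimes h)({}^{h}x\otimes{}^{h}k)$ for all $x,y,h,k\in G$. There is an epimorphism $\kappa:G\otimes G\to G'$ onto the derived subgroup with $\kappa(x\otimes y)=[x,y]$, and $J_2(G)=\ker\kappa$. The tensor center is $Z^\otimes(G)=\{g\in G\mid g\otimes y=1_{G\otimes G}\ \forall y\in G\}$, a subgroup of the center $Z(G)$. The tensor degree is $d^\otimes(G)=|\{(x,y)\in G\times G\mid x\otimes y=1_{G\otimes G}\}|/|G|^2$, and the commutativity degree is $d(G)=|\{(x,y)\in G\times G\mid [x,y]=1\}|/|G|^2$. *)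

(* Defs.v *)
From HB Require Import structures.
From mathcomp Require Import all_boot all_order all_algebra all_fingroup.
From mathcomp Require Import all_solvable.
From mathcomp Require Import finmap boolp classical_sets cardinality.
From mathcomp Require Import generic_quotient.

Set Implicit Arguments.
Unset Strict Implicit.
Unset Printing Implicit Defensive.

Import GRing.Theory.

Local Open Scope quotient_scope.
Local Open Scope group_scope.

(* A letter [(x, b)] stands for the generator [x] if [b = false] and for its
   formal inverse if [b = true]. *)
Notation word X := (seq (X * bool)).

Section Words.
Variable X : Type.

Definition inv_letter (l : X * bool) : X * bool := (l.1, ~~ l.2).
Definition inv_word (w : word X) : word X := rev (map inv_letter w).

Definition eval_letter (H : groupType) (f : X -> H) (l : X * bool) : H :=
  if l.2 then (f l.1)^-1 else f l.1.
Definition eval_word (H : groupType) (f : X -> H) (w : word X) : H :=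
  \prod_(l <- w) eval_letter f l.

Inductive word_eqv (R : word X -> word X -> Prop) : word X -> word X -> Prop :=
| weqv_refl w : word_eqv R w w
| weqv_sym w1 w2 : word_eqv R w1 w2 -> word_eqv R w2 w1
| weqv_trans w1 w2 w3 :
    word_eqv R w1 w2 -> word_eqv R w2 w3 -> word_eqv R w1 w3
| weqv_cat w1 w2 w1' w2' :
    word_eqv R w1 w1' -> word_eqv R w2 w2' ->
    word_eqv R (w1 ++ w2) (w1' ++ w2')
| weqv_cancel l : word_eqv R [:: l; inv_letter l] [::]
| weqv_rel w1 w2 : R w1 w2 -> word_eqv R w1 w2.

Lemma inv_letterK : involutive inv_letter.
Proof. by case=> x b; rewrite /inv_letter /= negbK. Qed.

Lemma inv_word_cat w1 w2 : inv_word (w1 ++ w2) = inv_word w2 ++ inv_word w1.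
Proof. by rewrite /inv_word map_cat rev_cat. Qed.

Lemma inv_wordK : involutive inv_word.
Proof.
by move=> w; rewrite /inv_word map_rev revK (mapK inv_letterK).
Qed.

Lemma weqv_invr R w : word_eqv R (w ++ inv_word w) [::].
Proof.
elim/last_ind: w => [|w l IHw]; first exact: weqv_refl.
rewrite -cats1 inv_word_cat catA -(catA w) /=.
apply: weqv_trans IHw; apply: weqv_cat; last exact: weqv_refl.
rewrite -[X in word_eqv _ _ X]cats0; apply: weqv_cat; first exact: weqv_refl.
exact: weqv_cancel.
Qed.

Lemma weqv_invl R w : word_eqv R (inv_word w ++ w) [::].
Proof. by rewrite -{2}[w]inv_wordK; exact: weqv_invr. Qed.

Lemma weqv_inv R w1 w2 :
  word_eqv R w1 w2 -> word_eqv R (inv_word w1) (inv_word w2).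
Proof.
move=> eqw; apply: (@weqv_trans _ _ (inv_word w1 ++ (w2 ++ inv_word w2))).
  rewrite -{1}[inv_word w1]cats0; apply: weqv_cat; first exact: weqv_refl.
  by apply: weqv_sym; exact: weqv_invr.
rewrite catA -[X in word_eqv _ _ X]cat0s; apply: weqv_cat; last exact: weqv_refl.
apply: weqv_trans (weqv_invl R w1); apply: weqv_cat; first exact: weqv_refl.
exact: weqv_sym.
Qed.

Lemma eval_word_cat (H : groupType) (f : X -> H) w1 w2 :
  eval_word f (w1 ++ w2) = eval_word f w1 * eval_word f w2.
Proof. exact: big_cat. Qed.

Lemma eval_word_eqv (H : groupType) (f : X -> H) R w1 w2 :
    (forall v1 v2, R v1 v2 -> eval_word f v1 = eval_word f v2) ->
  word_eqv R w1 w2 -> eval_word f w1 = eval_word f w2.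
Proof.
move=> fR; elim=> {w1 w2}.
- by [].
- by move=> w1 w2 _ ->.
- by move=> w1 w2 w3 _ -> _.
- by move=> w1 w2 w1' w2' _ IH1 _ IH2; rewrite !eval_word_cat IH1 IH2.
- case=> x b; rewrite /eval_word !big_cons !big_nil mulg1 /eval_letter /=.
  by case: b; rewrite /= ?mulVg ?mulgV.
- exact: fR.
Qed.

End Words.

Section Presentation.
Variables (X : choiceType) (R : word X -> word X -> Prop).

Definition weqvb (w1 w2 : word X) : bool := `[< word_eqv R w1 w2 >].

Lemma weqvb_refl : reflexive weqvb.
Proof. by move=> w; apply/asboolP; exact: weqv_refl. Qed.

Lemma weqvb_sym : symmetric weqvb.
Proof. by move=> w1 w2; apply/asboolP/asboolP; exact: weqv_sym. Qed.

Lemma weqvb_trans : transitive weqvb.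
Proof.
move=> w2 w1 w3 /asboolP w12 /asboolP w23.
by apply/asboolP; exact: weqv_trans w12 w23.
Qed.

Canonical weqvb_equiv := EquivRel weqvb weqvb_refl weqvb_sym weqvb_trans.

Definition presented := {eq_quot weqvb}.
HB.instance Definition _ := Choice.on presented.
HB.instance Definition _ := EqQuotient.on presented.

Lemma presented_eqP (w1 w2 : word X) :
  \pi_presented w1 = \pi_presented w2 <-> word_eqv R w1 w2.
Proof. by split=> [/eqmodP/asboolP | w12]; last apply/eqmodP/asboolP. Qed.

Lemma weqv_repr w : word_eqv R (repr (\pi_presented w)) w.
Proof. by apply/presented_eqP; rewrite reprK. Qed.

Lemma presentedW (P : presented -> Prop) :
  (forall w, P (\pi_presented w)) -> forall a, P a.
Proof. by move=> Pw a; rewrite -[a]reprK. Qed.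

Definition pone : presented := \pi_presented [::].
Definition pmul (a b : presented) : presented := \pi_presented (repr a ++ repr b).
Definition pinv (a : presented) : presented := \pi_presented (inv_word (repr a)).

Lemma pmul_pi w1 w2 :
  pmul (\pi_presented w1) (\pi_presented w2) = \pi_presented (w1 ++ w2).
Proof. by apply/presented_eqP; apply: weqv_cat; exact: weqv_repr. Qed.

Lemma pinv_pi w : pinv (\pi_presented w) = \pi_presented (inv_word w).
Proof. by apply/presented_eqP; apply: weqv_inv; exact: weqv_repr. Qed.

Lemma pmulA : associative pmul.
Proof.
move=> a b c; elim/presentedW: a => a; elim/presentedW: b => b; elim/presentedW: c => c.
by rewrite !pmul_pi catA.
Qed.

Lemma pmul1 : left_id pone pmul.
Proof. by move=> a; elim/presentedW: a => a; rewrite pmul_pi. Qed.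

Lemma pmulr1 : right_id pone pmul.
Proof. by move=> a; elim/presentedW: a => a; rewrite pmul_pi cats0. Qed.

Lemma pmulV : left_inverse pone pinv pmul.
Proof.
by move=> a; elim/presentedW: a => a; rewrite pinv_pi pmul_pi; apply/presented_eqP; exact: weqv_invl.
Qed.

Lemma pmulrV : right_inverse pone pinv pmul.
Proof.
by move=> a; elim/presentedW: a => a; rewrite pinv_pi pmul_pi; apply/presented_eqP; exact: weqv_invr.
Qed.

HB.instance Definition _ :=
  isGroup.Build presented pmulA pmul1 pmulr1 pmulV pmulrV.

Definition pgen (x : X) : presented := \pi_presented [:: (x, false)].

(* The homomorphism extending [f] when [f] respects the relations [R]
   (see [plift_gen] and [pliftM]). *)
Definition plift (H : groupType) (f : X -> H) (a : presented) : H :=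
  eval_word f (repr a).

Section Lift.
Variables (H : groupType) (f : X -> H).
Hypothesis fR : forall w1 w2, R w1 w2 -> eval_word f w1 = eval_word f w2.

Lemma plift_pi w : plift f (\pi_presented w) = eval_word f w.
Proof. by apply: eval_word_eqv fR _; exact: weqv_repr. Qed.

Lemma plift_gen x : plift f (pgen x) = f x.
Proof. by rewrite plift_pi /eval_word big_seq1. Qed.

Lemma pliftM : {morph plift f : a b / a * b}.
Proof.
move=> a b; elim/presentedW: a => a; elim/presentedW: b => b.
by rewrite [_ * _]pmul_pi !plift_pi eval_word_cat.
Qed.

End Lift.
End Presentation.

(* The left-action conventions below differ from the library's
   [x ^ y = y^-1 * x * y] and [[~ x, y] = x^-1 * y^-1 * x * y]. *)
Definition lconjg (G : groupType) (x y : G) : G := x * y * x^-1.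
Definition lcommg (G : groupType) (x y : G) : G := x * y * x^-1 * y^-1.

Inductive tensor_rel (G : groupType) : word (G * G) -> word (G * G) -> Prop :=
| tensor_rel_l x y h :
    tensor_rel [:: ((x * y, h), false)]
               [:: ((lconjg x y, lconjg x h), false); ((x, h), false)]
| tensor_rel_r x h k :
    tensor_rel [:: ((x, h * k), false)]
               [:: ((x, h), false); ((lconjg h x, lconjg h k), false)].

Section TensorSquare.
Variable G : groupType.

Definition tensor_square : groupType := presented (@tensor_rel G).

Definition tensor (g h : G) : tensor_square := pgen _ (g, h).

Lemma tensorMl x y h :
  tensor (x * y) h = tensor (lconjg x y) (lconjg x h) * tensor x h.
Proof.
by rewrite [RHS]pmul_pi; apply/presented_eqP/weqv_rel; exact: tensor_rel_l.
Qed.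

Lemma tensorMr x h k :
  tensor x (h * k) = tensor x h * tensor (lconjg h x) (lconjg h k).
Proof.
by rewrite [RHS]pmul_pi; apply/presented_eqP/weqv_rel; exact: tensor_rel_r.
Qed.

Definition kappa : tensor_square -> G := plift (fun u => lcommg u.1 u.2).

Lemma lcommg_tensor_rel (w1 w2 : word (G * G)) : tensor_rel w1 w2 ->
  eval_word (fun u => lcommg u.1 u.2) w1 = eval_word (fun u => lcommg u.1 u.2) w2.
Proof.
by case=> *; rewrite /eval_word !big_cons !big_nil /eval_letter /= !mulg1
  /lconjg /lcommg !invgM !invgK !mulgA ?(mulgKV, mulgK).
Qed.

Lemma kappa_tensor x y : kappa (tensor x y) = lcommg x y.
Proof. by rewrite /kappa plift_gen //; exact: lcommg_tensor_rel. Qed.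

Lemma kappaM : {morph kappa : a b / a * b}.
Proof. exact: (pliftM lcommg_tensor_rel). Qed.

Definition J2 : set tensor_square := [set t | kappa t = 1]%classic.

(* [fset_set] is empty on infinite sets, but for finite [G] the tensor square,
   hence [J2], is finite by a theorem of Ellis, so this is the true order. *)
Definition card_J2 : nat := #|` fset_set J2|.

End TensorSquare.

Section Degrees.
Variable gT : finGroupType.

Definition tensor_center : {set gT} := [set g | [forall y, tensor g y == 1]].

Definition tensor_degree : rat :=
  (#|[set u : gT * gT | tensor u.1 u.2 == 1%g]|%:R / #|gT|%:R ^+ 2)%R.

Definition commutativity_degree : rat :=
  (#|[set u : gT * gT | lcommg u.1 u.2 == 1%g]|%:R / #|gT|%:R ^+ 2)%R.

Lemma kappa_onto_der1 (x : gT) :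
  (exists t, kappa t = x) <-> x \in [~: [set: gT], [set: gT]].
Proof.
have lcommgE (a b : gT) : lcommg a b = [~ a^-1, b^-1].
  by rewrite commgEl conjgE !invgK /lcommg !mulgA.
split=> [[t <-]|].
  elim/presentedW: t => w; rewrite /kappa plift_pi; last exact: lcommg_tensor_rel.
  rewrite /eval_word; apply: group_prod => -[[a b] e] _.
  by case: e; rewrite /eval_letter /= ?groupV lcommgE mem_commg ?inE.
pose S : {set gT} := [set x | `[< exists t, kappa t = x >]].
have inS y : reflect (exists t, kappa t = y) (y \in S).
  by rewrite finset.inE; exact: asboolP.
have gS : group_set S.
  apply/group_setP; split=> [|_ _ /inS[t <-] /inS[u <-]].
    apply/inS; exists 1.
    by apply: (mulIg (kappa (1 : tensor_square gT))); rewrite -kappaM !mul1g.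
  by apply/inS; exists (t * u); rewrite kappaM.
suff sub : [~: [set: gT], [set: gT]] \subset Group gS.
  by move=> /(fintype.subsetP sub)/inS.
rewrite gen_subG; apply/fintype.subsetP => _ /imset2P[a b _ _ ->].
apply/inS; exists (tensor a^-1 b^-1).
by rewrite kappa_tensor lcommgE !invgK.
Qed.

End Degrees.

(* Main.v *)
(* Both degrees are averages over [x] of centralizer orders: [d] of ['C[x]], and
   [d^tensor] of the subgroup of those [y] with [tensor x y = 1]. On ['C[x]] the
   map [y |-> tensor x y] takes values in [J2] and its fibres lie in right
   cosets of the tensor centralizer, so the index of the latter in ['C[x]] is at
   most [|J2|]; summing over [x] outside the tensor center gives the lower
   bound. For [x] central but not tensor-central, the tensor centralizer is a
   proper subgroup of [G], hence has index at least [p], which gives the upper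
   bound. *)
Require Import Defs.
From mathcomp Require Import all_boot all_order all_algebra all_fingroup.
From mathcomp Require Import all_solvable.
From mathcomp Require boolp finmap cardinality.
From mathcomp Require Import ring.

Set Implicit Arguments.
Unset Strict Implicit.
Unset Printing Implicit Defensive.

Import Order.TTheory GRing.Theory Num.Theory.

Section Counting.
Local Open Scope nat_scope.

Lemma card_set_pair (S T : finType) (P : S -> T -> bool) :
  #|[set u : S * T | P u.1 u.2]| = \sum_x #|[set y | P x y]|.
Proof.
rewrite -sum1_card (eq_bigl (fun u : S * T => P u.1 u.2)) => [|u]; last first.
  by rewrite inE.
rewrite -(pair_big_dep xpredT P (fun _ _ => 1)) /=.
by apply: eq_bigr => x _; rewrite sum1dep_card.
Qed.

(** The codomain is a mere [eqType] because this is applied to [tensor x], whose codomain carries no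
    [finType] structure; a list [s] covering the values plays the role of the image. *)
Lemma leq_card_fibers (T : finType) (U : eqType) (f : T -> U) (D : {set T})
    (s : seq U) (k : nat) :
    (forall y, y \in D -> f y \in s) ->
    (forall t, #|[set y in D | f y == t]| <= k) ->
  #|D| <= size s * k.
Proof.
move=> Ds fib_le; apply: (@leq_trans (\sum_(t <- s) #|[set y in D | f y == t]|)).
  under eq_bigr do rewrite -sum1dep_card big_mkcondr.
  rewrite exchange_big -sum1_card; apply: leq_sum => y yD.
  by rewrite (big_rem (f y)) ?Ds //= eqxx.
rewrite -sum1_size big_distrl /=; apply: leq_sum => t _.
by rewrite mul1n.
Qed.

(** The index exceeds 1, so it has a least prime factor, which divides [#|K|] and is therefore at
    least [p]. *)
Lemma proper_card_muln_le (gT : finGroupType) (H K : {group gT}) (p : nat) :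
    (forall q, prime q -> q %| #|K| -> p <= q) ->
  H \proper K -> p * #|H| <= #|K|.
Proof.
move=> p_min /andP[sHK nsKH]; rewrite -(Lagrange sHK) mulnC leq_mul2l.
have idx_gt1 : 1 < #|K : H|%g by rewrite indexg_gt1.
apply/orP; right; apply: leq_trans (pdiv_leq (ltnW idx_gt1)).
apply: p_min; first exact: pdiv_prime.
exact: dvdn_trans (pdiv_dvd _) (dvdn_indexg _ _).
Qed.

End Counting.

Local Open Scope group_scope.

Section Tensor.
Variable G : groupType.
Implicit Types x y g : G.

Lemma lconjg_id x y : x * y = y * x -> lconjg x y = y.
Proof. by move=> xyC; rewrite /lconjg xyC mulgK. Qed.

Lemma lconjgM g x y : lconjg g (x * y) = lconjg g x * lconjg g y.
Proof. by rewrite /lconjg !mulgA mulgVK. Qed.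

Lemma lconjgJ g x y : lconjg g (lconjg x y) = lconjg (lconjg g x) (lconjg g y).
Proof. by rewrite /lconjg !invgM !invgK !mulgA !mulgVK. Qed.

Lemma lcommg_eq1P x y : lcommg x y = 1 <-> x * y = y * x.
Proof.
rewrite /lcommg; split=> [/divg1_eq xyx|->]; last by rewrite mulgK mulgV.
by rewrite -{2}xyx mulgVK.
Qed.

(** Conjugation is an automorphism of [G], so it carries each defining relation to another instance
    of itself. *)
Lemma tensor_conj_rel g (w1 w2 : word (G * G)) : tensor_rel w1 w2 ->
  eval_word (fun u => tensor (lconjg g u.1) (lconjg g u.2)) w1 =
  eval_word (fun u => tensor (lconjg g u.1) (lconjg g u.2)) w2.
Proof.
case=> *; rewrite /eval_word !big_cons !big_nil /eval_letter /= !mulg1 lconjgM.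
  by rewrite tensorMl -!lconjgJ.
by rewrite tensorMr -!lconjgJ.
Qed.

(* Conjugation by [g] induces an endomorphism of the tensor square. *)
Lemma tensor_conj_eq1 g x y :
  tensor x y = 1 -> tensor (lconjg g x) (lconjg g y) = 1.
Proof.
rewrite -(plift_gen (tensor_conj_rel g) (x, y)) -/(tensor x y) => ->.
by rewrite [LHS](plift_pi (tensor_conj_rel g)) /eval_word big_nil.
Qed.

Lemma tensorg1 x : tensor x 1 = 1.
Proof.
(* With both factors trivial the relation says that [tensor x 1] is idempotent. *)
have := tensorMr x 1 1; rewrite mulg1 /lconjg invg1 !mulg1 mul1g => e.
by apply: (mulgI (tensor x 1)); rewrite -e mulg1.
Qed.

Lemma kappa1 : kappa (1 : tensor_square G) = 1.
Proof. by rewrite -(tensorg1 1) kappa_tensor; apply/lcommg_eq1P. Qed.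

Lemma tensor_eq1_comm x y : tensor x y = 1 -> x * y = y * x.
Proof. by move=> xy1; apply/lcommg_eq1P; rewrite -kappa_tensor xy1 kappa1. Qed.

(** Conjugation by [y] fixes [x]; thus [tensor x] is a crossed homomorphism on the centralizer of
    [x]. *)
Lemma tensor_comm_mulr x y k :
  x * y = y * x -> tensor x (y * k) = tensor x y * tensor x (lconjg y k).
Proof. by move=> xyC; rewrite tensorMr [lconjg y x]lconjg_id. Qed.

(** The second factor of the expansion is the conjugate by [y] of [tensor x k], since [y] commutes
    with [x]. *)
Lemma tensor_eq1_mulr x y k :
  tensor x y = 1 -> tensor x k = 1 -> tensor x (y * k) = 1.
Proof.
move=> xy1 xk1; have xyC := tensor_eq1_comm xy1.
rewrite tensor_comm_mulr // xy1 mul1g -[in LHS](lconjg_id (esym xyC)).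
exact: tensor_conj_eq1.
Qed.

(** A nonzero [card_J2 G] forces [J2] to be finite, as [fset_set] sends infinite sets to the empty
    one. *)
Lemma mem_fset_set_J2 (t : tensor_square G) :
    card_J2 G != 0%N -> kappa t = 1 ->
  t \in finmap.enum_fset (cardinality.fset_set (@J2 G)).
Proof.
rewrite /card_J2 => J2n0 kt1.
case: (boolp.pselect (cardinality.finite_set (@J2 G))) => finJ.
  have:= cardinality.in_fset_set finJ t; rewrite -[LHS]/(_ \in _) => ->.
  exact/boolp.asboolP.
by move: J2n0; rewrite /cardinality.fset_set; case: boolp.pselect.
Qed.

End Tensor.

Section Centralizers.
Variable G : finGroupType.
Implicit Types x y : G.

Definition tensor_cent x : {set G} := [set y | tensor x y == 1].

Lemma group_set_tensor_cent x : group_set (tensor_cent x).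
Proof.
apply/group_setP; split=> [|y k]; rewrite !inE ?tensorg1 //.
by move=> /eqP xy1 /eqP xk1; rewrite tensor_eq1_mulr.
Qed.

Canonical tensor_cent_group x := Group (group_set_tensor_cent x).

Lemma lcommg_set_cent1 x : [set y | lcommg x y == 1] = 'C[x].
Proof.
apply/setP=> y; rewrite inE.
by apply/eqP/cent1P => [/lcommg_eq1P|xyC] //; apply/lcommg_eq1P.
Qed.

Lemma tensor_cent_sub x : tensor_cent x \subset 'C[x].
Proof.
apply/subsetP=> y; rewrite inE => /eqP/tensor_eq1_comm xyC.
exact/cent1P.
Qed.

Lemma tensor_centerE x : (x \in tensor_center G) = (tensor_cent x == setT).
Proof.
rewrite inE; apply/forallP/eqP => [x1|xT y].
  by apply/setP => y; rewrite !inE x1.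
by move: (in_setT y); rewrite -xT inE.
Qed.

Lemma tensor_center_sub : tensor_center G \subset 'Z([set: G]).
Proof.
apply/subsetP=> x; rewrite tensor_centerE => /eqP xT.
apply/centerP; split=> [|y _]; first by rewrite inE.
by apply/tensor_eq1_comm/eqP; move: (in_setT y); rewrite -xT inE.
Qed.

Lemma cent1_center x : x \in 'Z([set: G]) -> 'C[x] = setT.
Proof.
move=> /centerP[_ xC]; apply/setP=> y; rewrite in_setT; apply/cent1P.
by rewrite /commute xC ?inE.
Qed.

Lemma card_cent1_le_J2 x :
  card_J2 G != 0%N -> (#|'C[x]| <= card_J2 G * #|tensor_cent x|)%N.
Proof.
move=> J2n0; apply: (leq_card_fibers (f := tensor x) (D := 'C[x]))
    => [y /cent1P yxC|t].
  apply: mem_fset_set_J2 => //; rewrite kappa_tensor; exact/lcommg_eq1P.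
have [->|[y0]] := set_0Vmem [set y in 'C[x] | tensor x y == t].
  by rewrite cards0.
rewrite inE => /andP[/cent1P y0x /eqP xy0].
rewrite -(card_rcoset (tensor_cent x) y0); apply/subset_leq_card/subsetP => y.
rewrite inE => /andP[/cent1P yx /eqP xy].
rewrite mem_rcoset inE; apply/eqP.
apply: (mulgI t); rewrite mulg1 -{1}xy0 -xy.
(* In this form the product with [tensor x y0] recombines into [tensor x (y0 * (y0^-1 * y))]. *)
have -> : y * y0^-1 = lconjg y0 (y0^-1 * y) by rewrite /lconjg mulKVg.
by rewrite -tensor_comm_mulr // mulKVg.
Qed.

End Centralizers.

Local Open Scope ring_scope.

Theorem theorem2p3 (G : finGroupType) (p : nat) (p_prime : prime p)
    (p_dvd : (p %| #|G|)%N)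
    (p_min : forall q : nat, prime q -> (q %| #|G|)%N -> (p <= q)%N) :
  let d : rat := commutativity_degree G in
  let dT : rat := tensor_degree G in
  let n : rat := #|G|%:R in
  let j : rat := (card_J2 G)%:R in
  let z : rat := #|'Z([set: G])%g|%:R in
  let zT : rat := #|tensor_center G|%:R in
  d / j + zT / n * (1 - 1 / j) <= dT /\
  dT <= d - (1 - 1 / p%:R) * ((z - zT) / n).
Proof.
move=> d dT n j z zT.
have n_gt0 : 0 < n by rewrite ltr0n; apply/card_gt0P; exists 1%g.
have p_gt0 : 0 < p%:R :> rat by rewrite ltr0n prime_gt0.
set A := (\sum_(x : G) #|tensor_cent x|)%N; set C := (\sum_(x : G) #|'C[x]%g|)%N.
have dTE : dT = A%:R / n ^+ 2.
  by rewrite /dT /tensor_degree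
    (card_set_pair (fun x y : G => tensor x y == 1%g)).
have dE : d = C%:R / n ^+ 2.
  rewrite /d /commutativity_degree
    (card_set_pair (fun x y : G => lcommg x y == 1%g)).
  by under eq_bigr do rewrite lcommg_set_cent1.
have sum_mem (S : {set G}) k : (#|S| * k = \sum_x (x \in S) * k)%N.
  rewrite -sum1_card big_distrl big_mkcond /=.
  by apply: eq_bigr => x _; case: (x \in S).
(* This serves the case [card_J2 G = 0]. *)
have center_le_A : (#|tensor_center G| * #|G| <= A)%N.
  rewrite sum_mem; apply: leq_sum => x _; case: (boolP (x \in _)) => //=.
  by rewrite tensor_centerE => /eqP ->; rewrite mul1n cardsT.
(* The lower bound multiplied by [j * n ^+ 2], with negative terms moved across to stay in [nat]; it
   holds termwise in [x]. *)
have lower : card_J2 G != 0%N ->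
    (C + #|tensor_center G| * (card_J2 G * #|G|) <=
     card_J2 G * A + #|tensor_center G| * #|G|)%N.
  move=> j_n0; rewrite !sum_mem /A big_distrr -!big_split; apply: leq_sum => x _ /=.
  case: (boolP (x \in _)) => [|_]; last by rewrite !mul0n !addn0 card_cent1_le_J2.
  rewrite tensor_centerE => /eqP xT; rewrite xT cardsT !mul1n addnC leq_add2l.
  by rewrite -cardsT subset_leq_card.
(* The upper bound multiplied by [p * n ^+ 2], again termwise: for [x] in the set difference it
   reduces to [p * #|tensor_cent x| <= #|G|], elsewhere to [tensor_cent_sub]. *)
have upper : (p * A + (#|'Z([set: G])%g :\: tensor_center G|) * (p * #|G|) <=
     p * C + #|'Z([set: G])%g :\: tensor_center G| * #|G|)%N.
  rewrite !sum_mem /A /C !big_distrr -!big_split; apply: leq_sum => x _ /=.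
  case: (boolP (x \in _)) => [|_]; last first.
    by rewrite !mul0n !addn0 leq_mul2l subset_leq_card ?tensor_cent_sub ?orbT.
  rewrite inE tensor_centerE => /andP[xnT /cent1_center ->].
  rewrite !mul1n cardsT addnC leq_add2l -cardsT.
  apply: (@proper_card_muln_le _ (tensor_cent_group x) [set: G]%G).
    by move=> q; rewrite cardsT; exact: p_min.
  by rewrite properT.
have zE : #|'Z([set: G])%g :\: tensor_center G|%:R = z - zT.
  by rewrite cardsDS ?tensor_center_sub // natrB // subset_leq_card ?tensor_center_sub.
split; last first.
  rewrite dTE dE; move: upper; rewrite -(ler_nat rat) !natrD !natrM zE -/n => upper.
  rewrite -subr_ge0.
  have -> : C%:R / n ^+ 2 - (1 - 1 / p%:R) * ((z - zT) / n) - A%:R / n ^+ 2 =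
     (p%:R * C%:R + (z - zT) * n - (p%:R * A%:R + (z - zT) * (p%:R * n))) /
     (p%:R * n ^+ 2).
    by field; rewrite !gt_eqF.
  by rewrite divr_ge0 ?subr_ge0 // mulr_ge0 ?exprn_ge0 ?ltW.
have [j0|j_n0] := eqVneq (card_J2 G) 0%N.
  (* An infinite [J2] gets the junk order [0], and the bound becomes
     [zT / n <= dT]. *)
  rewrite /j j0 invr0 !mulr0 add0r subr0 mulr1 dTE.
  rewrite ler_pdivlMr ?exprn_gt0 // expr2 mulrA mulfVK ?gt_eqF //.
  by rewrite -natrM ler_nat.
have j_gt0 : 0 < j by rewrite ltr0n lt0n.
rewrite dTE dE; move: (lower j_n0); rewrite -(ler_nat rat) !natrD !natrM.
rewrite -/n -/j -/zT => {}lower; rewrite -subr_ge0.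
have -> : A%:R / n ^+ 2 - (C%:R / n ^+ 2 / j + zT / n * (1 - 1 / j)) =
   (j * A%:R + zT * n - (C%:R + zT * (j * n))) / (j * n ^+ 2).
  by field; rewrite !gt_eqF.
by rewrite divr_ge0 ?subr_ge0 // mulr_ge0 ?exprn_ge0 ?ltW.
Qed.
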